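(* Let $\Omega \subseteq \mathbb{C}$ be an open set which is the union of open half-lines, and let $F \subseteq \mathbb{N}_0$ be a non-empty set. Then $H_{F}^{\infty}(\Omega)=H_{\widetilde{F}}^{\infty}(\Omega)$ (as sets), where $\widetilde{F}=\{ l\in \mathbb{N}_0: \min F\leqslant l \leqslant \sup F\}$.
   Context: $\mathbb{N}_0=\{0,1,2,\dots\}$; $\sup F$ may be $+\infty$. For an open set $\Omega\subseteq\mathbb{C}$ and a non-empty set $F\subseteq\mathbb{N}_0$, $H_F^\infty(\Omega)$ is the set of holomorphic functions $f$ on $\Omega$ such that the derivative $f^{(l)}$ is bounded on $\Omega$ for all $l\in F$. An open half-line is a set of the form $\{\beta+th: t>0\}$ with $\beta,h\in\mathbb{C}$, $|h|=1$. *)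

(* Defs.v *)
From Stdlib Require Import Reals.
From Coquelicot Require Export Coquelicot.

Local Open Scope R_scope.

Definition half_line (beta h : C) : C -> Prop :=
  fun z => exists t : R, 0 < t /\ z = (beta + RtoC t * h)%C.

Definition is_open_half_line (L : C -> Prop) : Prop :=
  exists beta h : C, Cmod h = 1 /\ forall z : C, L z <-> half_line beta h z.

Definition union_of_open_half_lines (Omega : C -> Prop) : Prop :=
  exists family : (C -> Prop) -> Prop,
    (forall L, family L -> is_open_half_line L) /\
    (forall z : C, Omega z <-> exists L, family L /\ L z).

(* [ex_derive] on functions C -> C is complex differentiability. *)
Definition holomorphic_on (Omega : C -> Prop) (f : C -> C) : Prop :=
  forall z : C, Omega z -> ex_derive f z.

(* [C_derive] is total; it is the complex derivative at every point where the
   function is complex differentiable ([C_derive_correct]). *)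
Fixpoint C_derive_n (f : C -> C) (n : nat) : C -> C :=
  match n with
  | O => f
  | S n => C_derive (C_derive_n f n)
  end.

Definition bounded_on (Omega : C -> Prop) (f : C -> C) : Prop :=
  exists M : R, forall z : C, Omega z -> Cmod (f z) <= M.

(* A function on Omega is represented by any total function extending it;
   for open Omega the choice of extension is irrelevant ([H_inf_ext]). *)
Definition H_inf (F : nat -> Prop) (Omega : C -> Prop) (f : C -> C) : Prop :=
  holomorphic_on Omega f /\
  forall l : nat, F l -> bounded_on Omega (C_derive_n f l).

Definition is_min (F : nat -> Prop) (m : nat) : Prop :=
  F m /\ forall k : nat, F k -> (m <= k)%nat.

Definition sup_nat (F : nat -> Prop) : Rbar :=
  Lub_Rbar (fun x : R => exists n : nat, F n /\ x = INR n).

Definition fill (F : nat -> Prop) (l : nat) : Prop :=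
  (exists m : nat, is_min F m /\ (m <= l)%nat) /\
  Rbar_le (INR l) (sup_nat F).

Lemma C_derive_ext_on (Omega : C -> Prop) (f g : C -> C) :
  open Omega -> (forall z, Omega z -> f z = g z) ->
  forall z, Omega z -> C_derive f z = C_derive g z.
Proof.
intros HO Hfg [x y] Hz.
destruct (HO _ Hz) as [e He].
unfold C_derive, C_lim; cbn [fst snd].
apply f_equal2; apply (f_equal real), Lim_ext_loc; exists e;
  intros u Hu _; change R in u; cbn beta;
  rewrite (Hfg _ Hz), (Hfg (u, y)); try reflexivity;
  apply He; split; exact Hu || apply ball_center.
Qed.

Lemma H_inf_ext (F : nat -> Prop) (Omega : C -> Prop) (f g : C -> C) :
  open Omega -> (forall z, Omega z -> f z = g z) ->
  H_inf F Omega f -> H_inf F Omega g.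
Proof.
intros HO Hfg [Hhol Hbd]; split.
- intros z Hz.
  apply ex_derive_ext_loc with (2 := Hhol z Hz).
  apply locally_C; destruct (HO z Hz) as [e He].
  exists e; intros u Hu; apply Hfg, He, Hu.
- assert (E : forall n z, Omega z -> C_derive_n f n z = C_derive_n g n z).
  { induction n as [|n IH]; [exact Hfg|].
    exact (C_derive_ext_on _ _ _ HO IH). }
  intros l Hl; destruct (Hbd l Hl) as [M HM].
  exists M; intros z Hz; rewrite <- E by exact Hz; exact (HM z Hz).
Qed.

(* Main.v *)
Require Import Defs.
From Stdlib Require Import Reals Lra Lia Wf_nat ClassicalEpsilon.
From Coquelicot Require Import Coquelicot.
From Corelib Require Import ssreflect.
Local Open Scope R_scope.

(* Along a half-line contained in Omega, the derivatives of f are, up to factors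
   of modulus 1, the successive derivatives of a function u of a real variable
   t >= 0.  If u is bounded by A, every interval of length 2^n - 1 contains a
   point where |u^(n)| <= 2^n A; if u^(n+1) is bounded too, then so is u^(n), and
   one descends to the intermediate derivatives.  The bounds depend only on A, the
   bound of the top derivative and the orders, hence are uniform on Omega.

   That a holomorphic function has holomorphic derivative is obtained from
   Goursat's theorem on rectangles and Cauchy's formula
   f(z) W(z) = int f(w) / (w - z) dw.  The value of W(z) = int dw / (w - z) is not
   needed, only that its imaginary part is positive: both sides can be
   differentiated under the integral sign, so f = Phi / W is twice
   differentiable. *)

(** * Complex differentiability *)

(** An epsilon-delta form with an explicit remainder, which the integral estimates below can use and
    produce directly. *)
Definition cdiff (f : C -> C) (z l : C) : Prop :=
  forall eps : R, 0 < eps -> exists delta : R, 0 < delta /\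
  forall w : C, Cmod (w - z) < delta ->
    Cmod (f w - f z - (w - z) * l) <= eps * Cmod (w - z).

Lemma cdiff_is_derive (f : C -> C) (z l : C) :
  cdiff f z l <-> is_derive (K := C_AbsRing) (V := C_NormedModule) f z l.
Proof.
split.
- intros H; split; [apply is_linear_scal_l|].
  intros x Hx; rewrite <- (is_filter_lim_locally_unique _ _ Hx).
  intros eps; destruct (H eps (cond_pos eps)) as [d [Hd Hf]].
  exists (mkposreal d Hd); intros w Hw; exact (Hf w Hw).
- intros [_ H] eps Heps.
  destruct (H z (fun P HP => HP) (mkposreal eps Heps)) as [d Hf].
  exists d; split; [apply cond_pos|]; intros w Hw; exact (Hf w Hw).
Qed.

(** The library rules for the identity, products and inner functions of compositions see [C] as a
    module over itself, a structure distinct from [C_NormedModule]; [cdiff] mediates between the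
    two. *)
Lemma cdiff_is_derive_self (f : C -> C) (z l : C) :
  cdiff f z l <->
  is_derive (K := C_AbsRing) (V := AbsRing_NormedModule C_AbsRing) f z l.
Proof.
split.
- intros H; split; [apply is_linear_scal_l|].
  intros x Hx; rewrite <- (is_filter_lim_locally_unique _ _ Hx).
  intros eps; destruct (H eps (cond_pos eps)) as [d [Hd Hf]].
  exists (mkposreal d Hd); intros w Hw; exact (Hf w Hw).
- intros [_ H] eps Heps.
  destruct (H z (fun P HP => HP) (mkposreal eps Heps)) as [d Hf].
  exists d; split; [apply cond_pos|]; intros w Hw; exact (Hf w Hw).
Qed.

Lemma cdiff_C_derive (f : C -> C) (z l : C) : cdiff f z l -> C_derive f z = l.
Proof. intros H; apply is_C_derive_unique, cdiff_is_derive, H. Qed.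

Lemma cdiff_ext_ball (f g : C -> C) (z l : C) (r : R) :
  0 < r -> (forall w, Cmod (w - z) < r -> f w = g w) ->
  cdiff f z l -> cdiff g z l.
Proof.
intros Hr E H eps Heps; destruct (H eps Heps) as [d [Hd Hf]].
exists (Rmin d r); split; [now apply Rmin_pos|]; intros w Hw.
rewrite <- !E.
- apply Hf; apply Rlt_le_trans with (1 := Hw); apply Rmin_l.
- replace (z - z)%C with (RtoC 0) by ring; now rewrite Cmod_0.
- apply Rlt_le_trans with (1 := Hw); apply Rmin_r.
Qed.

Lemma cdiff_const (c z : C) : cdiff (fun _ => c) z 0.
Proof. apply cdiff_is_derive; apply: is_derive_const. Qed.

Lemma cdiff_id (z : C) : cdiff (fun w => w) z 1.
Proof. apply cdiff_is_derive_self; apply: is_derive_id. Qed.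

Lemma cdiff_plus (f g : C -> C) (z l m : C) :
  cdiff f z l -> cdiff g z m -> cdiff (fun w => f w + g w)%C z (l + m)%C.
Proof.
intros Hf Hg; apply cdiff_is_derive.
apply: is_derive_plus; now apply cdiff_is_derive.
Qed.

Lemma cdiff_mult (f g : C -> C) (z l m : C) :
  cdiff f z l -> cdiff g z m ->
  cdiff (fun w => f w * g w)%C z (l * g z + f z * m)%C.
Proof.
intros Hf Hg; apply cdiff_is_derive_self.
apply: is_derive_mult; try now apply cdiff_is_derive_self.
exact Cmult_comm.
Qed.

Lemma cdiff_minus (f g : C -> C) (z l m : C) :
  cdiff f z l -> cdiff g z m -> cdiff (fun w => f w - g w)%C z (l - m)%C.
Proof.
intros Hf Hg; apply cdiff_is_derive.
apply: is_derive_minus; now apply cdiff_is_derive.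
Qed.

(** The remainder is exactly e^2 / (u^2 (u + e)). The bound depends on [u] only through [r], so it
    also serves to differentiate under the integral sign. *)
Lemma Cinv_taylor1 (u e : C) (r : R) :
  0 < r -> r <= Cmod u -> r <= Cmod (u + e) ->
  Cmod (/ (u + e) - / u - e * - / (u * u)) <= (/ r) ^ 3 * Cmod e ^ 2.
Proof.
intros Hr Hu Hue.
assert (Hu0 : u <> 0) by (intros ->; rewrite Cmod_0 in Hu; lra).
assert (He0 : (u + e)%C <> 0) by (intros E; rewrite E Cmod_0 in Hue; lra).
replace (/ (u + e) - / u - e * - / (u * u))%C
  with (e * e * (/ u * / u * / (u + e)))%C by (field; auto).
rewrite !Cmod_mult !Cmod_inv //.
assert (I : forall x, r <= x -> 0 <= / x <= / r).
{ intros x Hx; split; [left; apply Rinv_0_lt_compat; lra|].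
  apply Rinv_le_contravar; lra. }
apply I in Hu; apply I in Hue.
assert (H := Cmod_ge_0 e).
assert (/ Cmod u * / Cmod u * / Cmod (u + e) <= / r * / r * / r).
{ apply Rmult_le_compat; try apply Hue; [apply Rmult_le_pos; apply Hu|].
  apply Rmult_le_compat; apply Hu. }
nra.
Qed.

Lemma cdiff_inv (z : C) : z <> 0 -> cdiff Cinv z (- / (z * z))%C.
Proof.
intros Hz eps Heps.
assert (Hc := proj1 (Cmod_gt_0 z) Hz).
(* Points within |z|/2 of z still have modulus at least |z|/2, the lower bound that [Cinv_taylor1]
   asks for. *)
set (r := Cmod z / 2); assert (Hr : 0 < r) by (unfold r; lra).
set (M := (/ r) ^ 3).
assert (HM : 0 < M) by (apply pow_lt, Rinv_0_lt_compat, Hr).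
exists (Rmin r (eps / M)); split.
{ apply Rmin_pos; [exact Hr|]; now apply Rdiv_lt_0_compat. }
intros w Hw.
assert (H1 : Cmod (w - z) < r) by (apply Rlt_le_trans with (1 := Hw), Rmin_l).
assert (H2 : Cmod (w - z) * M < eps).
{ apply Rlt_div_r; [exact HM|]; apply Rlt_le_trans with (1 := Hw), Rmin_r. }
assert (T := Cinv_taylor1 z (w - z) r Hr).
replace (z + (w - z))%C with w in T by ring.
apply Rle_trans with (M * Cmod (w - z) ^ 2).
- apply T; [unfold r; lra|].
  assert (Cmod z <= Cmod w + Cmod (w - z)).
  { replace z with (w + - (w - z))%C at 1 by ring.
    apply Rle_trans with (1 := Cmod_triangle _ _); rewrite Cmod_opp; lra. }
  unfold r in *; lra.
- assert (P := Cmod_ge_0 (w - z)); nra.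
Qed.

Lemma cdiff_comp_inv (g : C -> C) (z l : C) :
  cdiff g z l -> g z <> 0 ->
  cdiff (fun w => / g w)%C z (l * - / (g z * g z))%C.
Proof.
intros Hg H0; apply cdiff_is_derive.
apply: is_derive_comp; [apply cdiff_is_derive, cdiff_inv, H0|].
now apply cdiff_is_derive_self.
Qed.

Definition cdiffable (f : C -> C) (z : C) : Prop := exists l, cdiff f z l.

Lemma cdiffable_continuous (f : C -> C) (z : C) :
  cdiffable f z -> forall eps : R, 0 < eps -> exists delta : R, 0 < delta /\
  forall w : C, Cmod (w - z) < delta -> Cmod (f w - f z) < eps.
Proof.
intros [l H] eps Heps; destruct (H 1 Rlt_0_1) as [d [Hd Hf]].
set (M := 1 + Cmod l); assert (HM : 0 < M).
{ unfold M; assert (P := Cmod_ge_0 l); lra. }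
exists (Rmin d (eps / M)); split.
{ apply Rmin_pos; [exact Hd|]; now apply Rdiv_lt_0_compat. }
intros w Hw.
assert (H2 : Cmod (w - z) * M < eps).
{ apply Rlt_div_r; [exact HM|]; apply Rlt_le_trans with (1 := Hw), Rmin_r. }
assert (H1 := Hf w (Rlt_le_trans _ _ _ Hw (Rmin_l _ _))).
replace (f w - f z)%C with (f w - f z - (w - z) * l + (w - z) * l)%C by ring.
apply Rle_lt_trans with (1 := Cmod_triangle _ _).
rewrite Cmod_mult; unfold M in H2; lra.
Qed.

Lemma cdiffable_const (c z : C) : cdiffable (fun _ => c) z.
Proof. eexists; apply cdiff_const. Qed.
Lemma cdiffable_id (z : C) : cdiffable (fun w => w) z.
Proof. eexists; apply cdiff_id. Qed.
Lemma cdiffable_plus (f g : C -> C) (z : C) :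
  cdiffable f z -> cdiffable g z -> cdiffable (fun w => f w + g w)%C z.
Proof. intros [l Hl] [m Hm]; eexists; apply cdiff_plus; eassumption. Qed.
Lemma cdiffable_minus (f g : C -> C) (z : C) :
  cdiffable f z -> cdiffable g z -> cdiffable (fun w => f w - g w)%C z.
Proof. intros [l Hl] [m Hm]; eexists; apply cdiff_minus; eassumption. Qed.
Lemma cdiffable_mult (f g : C -> C) (z : C) :
  cdiffable f z -> cdiffable g z -> cdiffable (fun w => f w * g w)%C z.
Proof. intros [l Hl] [m Hm]; eexists; apply cdiff_mult; eassumption. Qed.
Lemma cdiffable_inv (g : C -> C) (z : C) :
  cdiffable g z -> g z <> 0 -> cdiffable (fun w => / g w)%C z.
Proof. intros [l Hl] H0; eexists; apply cdiff_comp_inv; eassumption. Qed.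

(** * Integrals over rectangle boundaries *)

(** Taken componentwise, so that the theory of real-valued integrals applies. *)
Definition seg_int (g : R -> C) (a b : R) : C :=
  (RInt (fun t => fst (g t)) a b, RInt (fun t => snd (g t)) a b).

Definition seg_integrable (g : R -> C) (a b : R) : Prop :=
  ex_RInt (fun t => fst (g t)) a b /\ ex_RInt (fun t => snd (g t)) a b.

(** The isometry hypothesis on the path covers horizontal and vertical segments at once. *)
Lemma cdiffable_line_continuous (f : C -> C) (gam : R -> C) (t : R) :
  (forall s t, Cmod (gam s - gam t) = Rabs (s - t)) -> cdiffable f (gam t) ->
  continuous (fun t => fst (f (gam t))) t /\
  continuous (fun t => snd (f (gam t))) t.
Proof.
intros Hg Hf; split; apply continuity_pt_filterlim; intros eps Heps;
  destruct (cdiffable_continuous f _ Hf eps Heps) as [d [Hd H]];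
  exists d; (split; [exact Hd|]); intros s [_ Hs];
  simpl in Hs |- *; unfold Rdist in *;
  rewrite <- Hg in Hs; apply Rle_lt_trans with (2 := H _ Hs);
  apply Rle_trans with (2 := Rmax_Cmod _); [apply Rmax_l | apply Rmax_r].
Qed.

Lemma seg_integrable_line (f : C -> C) (gam : R -> C) (a b : R) :
  a <= b ->
  (forall s t, Cmod (gam s - gam t) = Rabs (s - t)) ->
  (forall t, a <= t <= b -> cdiffable f (gam t)) ->
  seg_integrable (fun t => f (gam t)) a b.
Proof.
intros Hab Hg Hf.
split; apply: ex_RInt_continuous; intros t; rewrite Rmin_left // Rmax_right //;
  intros Ht; apply cdiffable_line_continuous; auto.
Qed.

Lemma Cmod_Ci : Cmod Ci = 1.
Proof.
unfold Ci, Cmod; simpl.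
replace (0 * (0 * 1) + 1 * (1 * 1)) with 1 by ring; apply sqrt_1.
Qed.

Lemma Cmod_h (y s t : R) : Cmod (((s, y) : C) - (t, y)) = Rabs (s - t).
Proof.
replace (((s, y) : C) - (t, y))%C with (RtoC (s - t)); [apply Cmod_R|].
apply injective_projections; simpl; ring.
Qed.

Lemma Cmod_v (x s t : R) : Cmod (((x, s) : C) - (x, t)) = Rabs (s - t).
Proof.
replace (((x, s) : C) - (x, t))%C with (Ci * RtoC (s - t))%C.
- rewrite Cmod_mult Cmod_R Cmod_Ci; ring.
- apply injective_projections; simpl; ring.
Qed.

Lemma seg_integrable_h (f : C -> C) (a b y : R) :
  a <= b -> (forall x, a <= x <= b -> cdiffable f (x, y)) ->
  seg_integrable (fun x => f (x, y)) a b.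
Proof.
intros Hab Hf; apply (seg_integrable_line f (fun x => (x, y))); auto using Cmod_h.
Qed.

Lemma seg_integrable_v (f : C -> C) (c d x : R) :
  c <= d -> (forall y, c <= y <= d -> cdiffable f (x, y)) ->
  seg_integrable (fun y => f (x, y)) c d.
Proof.
intros Hab Hf; apply (seg_integrable_line f (fun y => (x, y))); auto using Cmod_v.
Qed.

Lemma seg_integrable_lin (g h : R -> C) (k : C) (a b : R) :
  seg_integrable g a b -> seg_integrable h a b ->
  seg_integrable (fun t => g t + k * h t)%C a b.
Proof.
intros [G1 G2] [H1 H2]; split; simpl.
- apply: ex_RInt_plus; [exact G1|].
  apply: ex_RInt_minus; apply: ex_RInt_scal; assumption.
- apply: ex_RInt_plus; [exact G2|].
  apply: ex_RInt_plus; apply: ex_RInt_scal; assumption.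
Qed.

Lemma seg_int_ext (g h : R -> C) (a b : R) :
  (forall t, g t = h t) -> seg_int g a b = seg_int h a b.
Proof. intros E; apply injective_projections; apply RInt_ext; intros t _; now rewrite E. Qed.

Lemma seg_integrable_ext (g h : R -> C) (a b : R) :
  (forall t, g t = h t) -> seg_integrable g a b -> seg_integrable h a b.
Proof.
intros E [G1 G2]; split; [revert G1 | revert G2]; apply ex_RInt_ext;
  intros t _; now rewrite E.
Qed.

(** A single linearity rule with a complex factor; differences are obtained from it with [k] equal
    to -1. *)
Lemma seg_int_lin (g h : R -> C) (k : C) (a b : R) :
  seg_integrable g a b -> seg_integrable h a b ->
  seg_int (fun t => g t + k * h t)%C a b = (seg_int g a b + k * seg_int h a b)%C.
Proof.
intros [G1 G2] [H1 H2]; unfold seg_int.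
apply injective_projections; simpl.
- transitivity (RInt (fun t => fst (g t)) a b +
    (RInt (fun t => fst k * fst (h t)) a b - RInt (fun t => snd k * snd (h t)) a b)).
  + etransitivity; [apply: RInt_plus; [exact G1|]|].
    * apply: ex_RInt_minus; apply: ex_RInt_scal; assumption.
    * apply (f_equal (Rplus _)); apply: RInt_minus; apply: ex_RInt_scal; assumption.
  + apply (f_equal (Rplus _)); apply f_equal2; apply: RInt_scal; assumption.
- transitivity (RInt (fun t => snd (g t)) a b +
    (RInt (fun t => fst k * snd (h t)) a b + RInt (fun t => snd k * fst (h t)) a b)).
  + etransitivity; [apply: RInt_plus; [exact G2|]|].
    * apply: ex_RInt_plus; apply: ex_RInt_scal; assumption.
    * apply (f_equal (Rplus _)); apply: RInt_plus; apply: ex_RInt_scal; assumption.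
  + apply (f_equal (Rplus _)); apply f_equal2; apply: RInt_scal; assumption.
Qed.

(** Bounding the two components separately costs a factor sqrt 2, rounded up to 2. *)
Lemma seg_int_le (g : R -> C) (a b M : R) :
  a <= b -> seg_integrable g a b ->
  (forall t, a <= t <= b -> Cmod (g t) <= M) ->
  Cmod (seg_int g a b) <= 2 * ((b - a) * M).
Proof.
intros Hab [G1 G2] HM.
assert (K1 : Rabs (fst (seg_int g a b)) <= (b - a) * M).
{ apply abs_RInt_le_const; auto; intros t Ht.
  apply Rle_trans with (2 := HM t Ht), Rle_trans with (2 := Rmax_Cmod _), Rmax_l. }
assert (K2 : Rabs (snd (seg_int g a b)) <= (b - a) * M).
{ apply abs_RInt_le_const; auto; intros t Ht.
  apply Rle_trans with (2 := HM t Ht), Rle_trans with (2 := Rmax_Cmod _), Rmax_r. }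
apply Rle_trans with (1 := Cmod_2Rmax _).
assert (H0 := Rabs_pos (fst (seg_int g a b))).
assert (sqrt 2 <= 2).
{ rewrite <- (sqrt_pow2 2) at 2 by lra; apply sqrt_le_1; lra. }
apply Rmult_le_compat; [apply sqrt_pos | | assumption | now apply Rmax_lub].
apply Rle_trans with (1 := H0), Rmax_l.
Qed.

Lemma seg_int_const (k : C) (a b : R) :
  seg_int (fun _ => k) a b = (RtoC (b - a) * k)%C.
Proof.
unfold seg_int; rewrite !RInt_const; apply injective_projections; simpl;
  unfold scal; simpl; unfold mult; simpl; ring.
Qed.

Lemma seg_int_Chasles (g : R -> C) (a b c : R) :
  seg_integrable g a b -> seg_integrable g b c ->
  seg_int g a c = (seg_int g a b + seg_int g b c)%C.
Proof.
intros [G1 G2] [H1 H2]; apply injective_projections; simpl; symmetry;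
  apply: RInt_Chasles; assumption.
Qed.

Definition in_rect (a b c d : R) (w : C) : Prop :=
  a <= fst w <= b /\ c <= snd w <= d.

Definition on_rect_boundary (a b c d : R) (w : C) : Prop :=
  (a <= fst w <= b /\ (snd w = c \/ snd w = d)) \/
  ((fst w = a \/ fst w = b) /\ c <= snd w <= d).

(* Opposite sides are grouped in one integral, so that the integrands are
   constant when [f] is affine. *)
Definition rect_int (f : C -> C) (a b c d : R) : C :=
  (seg_int (fun x => f (x, c) - f (x, d)) a b +
   Ci * seg_int (fun y => f (b, y) - f (a, y)) c d)%C.

Lemma rect_boundary_integrable (f : C -> C) (a b c d : R) :
  a <= b -> c <= d ->
  (forall w, on_rect_boundary a b c d w -> cdiffable f w) ->
  seg_integrable (fun x => f (x, c) - f (x, d))%C a b /\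
  seg_integrable (fun y => f (b, y) - f (a, y))%C c d.
Proof.
intros Hab Hcd Hf; split.
- apply seg_integrable_ext with (fun x => f (x, c) + - (1) * f (x, d))%C.
  { intros; ring. }
  apply seg_integrable_lin; apply seg_integrable_h; auto;
    intros x Hx; apply Hf; left; simpl; auto.
- apply seg_integrable_ext with (fun y => f (b, y) + - (1) * f (a, y))%C.
  { intros; ring. }
  apply seg_integrable_lin; apply seg_integrable_v; auto;
    intros x Hx; apply Hf; right; simpl; auto.
Qed.

Lemma rect_int_ext (f g : C -> C) (a b c d : R) :
  (forall w, f w = g w) -> rect_int f a b c d = rect_int g a b c d.
Proof.
intros E; unfold rect_int; apply f_equal2; [|apply f_equal];
  apply seg_int_ext; intros t; now rewrite !E.
Qed.

Lemma rect_int_lin (f g : C -> C) (k : C) (a b c d : R) :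
  a <= b -> c <= d ->
  (forall w, on_rect_boundary a b c d w -> cdiffable f w) ->
  (forall w, on_rect_boundary a b c d w -> cdiffable g w) ->
  rect_int (fun w => f w + k * g w)%C a b c d =
  (rect_int f a b c d + k * rect_int g a b c d)%C.
Proof.
intros Hab Hcd Hf Hg.
destruct (rect_boundary_integrable f a b c d) as [F1 F2]; auto.
destruct (rect_boundary_integrable g a b c d) as [G1 G2]; auto.
unfold rect_int.
rewrite (seg_int_ext _ (fun x => (f (x, c) - f (x, d)) + k * (g (x, c) - g (x, d)))%C);
  [|intros; ring].
rewrite (seg_int_ext (fun y => _ - (f (a, y) + _))%C
  (fun y => (f (b, y) - f (a, y)) + k * (g (b, y) - g (a, y)))%C);
  [|intros; ring].
rewrite !seg_int_lin //; ring.
Qed.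

(** The differences between opposite sides are the constants (c - d) i B and (b - a) B, whose
    contributions cancel. *)
Lemma rect_int_affine (A B : C) (a b c d : R) :
  rect_int (fun w => A + w * B)%C a b c d = 0.
Proof.
unfold rect_int.
rewrite (seg_int_ext (fun x => A + (x, c) * B - _)%C (fun _ => RtoC (c - d) * Ci * B)%C).
- rewrite (seg_int_ext (fun y => A + (b, y) * B - _)%C (fun _ => RtoC (b - a) * B)%C).
  + rewrite !seg_int_const !RtoC_minus. ring.
  + intros t; apply injective_projections; simpl; ring.
- intros t; apply injective_projections; simpl; ring.
Qed.

(** The 4 is a 2 for the difference of two opposite sides times the 2 of [seg_int_le]. *)
Lemma rect_int_le (f : C -> C) (a b c d M : R) :
  a <= b -> c <= d ->
  (forall w, on_rect_boundary a b c d w -> cdiffable f w) ->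
  (forall w, on_rect_boundary a b c d w -> Cmod (f w) <= M) ->
  Cmod (rect_int f a b c d) <= 4 * ((b - a) + (d - c)) * M.
Proof.
intros Hab Hcd Hf HM.
destruct (rect_boundary_integrable f a b c d) as [F1 F2]; auto.
unfold rect_int; apply Rle_trans with (1 := Cmod_triangle _ _).
assert (Hs : forall u v, Cmod u <= M -> Cmod v <= M -> Cmod (u - v) <= 2 * M).
{ intros u v Hu Hv; apply Rle_trans with (1 := Cmod_triangle _ _).
  rewrite Cmod_opp; lra. }
assert (H1 := seg_int_le _ a b (2 * M) Hab F1).
assert (H2 := seg_int_le _ c d (2 * M) Hcd F2).
rewrite Cmod_mult Cmod_Ci.
assert (K1 := H1 (fun t Ht => Hs _ _ (HM (t, c) ltac:(left; simpl; auto))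
                                     (HM (t, d) ltac:(left; simpl; auto)))).
assert (K2 := H2 (fun t Ht => Hs _ _ (HM (b, t) ltac:(right; simpl; auto))
                                     (HM (a, t) ltac:(right; simpl; auto)))).
lra.
Qed.

Lemma rect_boundary_integrable_sides (f : C -> C) (a b c d : R) :
  a <= b -> c <= d ->
  (forall w, on_rect_boundary a b c d w -> cdiffable f w) ->
  seg_integrable (fun x => f (x, c)) a b /\ seg_integrable (fun x => f (x, d)) a b /\
  seg_integrable (fun y => f (a, y)) c d /\ seg_integrable (fun y => f (b, y)) c d.
Proof.
intros Hab Hcd Hf; split; [|split; [|split]].
- apply seg_integrable_h; auto; intros x Hx; apply Hf; left; simpl; auto.
- apply seg_integrable_h; auto; intros x Hx; apply Hf; left; simpl; auto.
- apply seg_integrable_v; auto; intros x Hx; apply Hf; right; simpl; auto.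
- apply seg_integrable_v; auto; intros x Hx; apply Hf; right; simpl; auto.
Qed.

Lemma rect_int_sides (f : C -> C) (a b c d : R) :
  a <= b -> c <= d ->
  (forall w, on_rect_boundary a b c d w -> cdiffable f w) ->
  rect_int f a b c d =
  (seg_int (fun x => f (x, c)) a b - seg_int (fun x => f (x, d)) a b +
   Ci * (seg_int (fun y => f (b, y)) c d - seg_int (fun y => f (a, y)) c d))%C.
Proof.
intros Hab Hcd Hf; unfold rect_int.
rewrite (seg_int_ext (fun x => f (x, c) - _)%C (fun x => f (x, c) + - (1) * f (x, d))%C);
  [|intros; ring].
rewrite (seg_int_ext (fun y => f (b, y) - _)%C (fun y => f (b, y) + - (1) * f (a, y))%C);
  [|intros; ring].
destruct (rect_boundary_integrable_sides f a b c d) as [H1 [H2 [H3 H4]]]; auto.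
rewrite !seg_int_lin //; ring.
Qed.

(** The common side at [m] is traversed in opposite directions by the two halves and cancels. *)
Lemma rect_int_split_h (f : C -> C) (a m b c d : R) :
  a <= m <= b -> c <= d ->
  (forall w, on_rect_boundary a m c d w -> cdiffable f w) ->
  (forall w, on_rect_boundary m b c d w -> cdiffable f w) ->
  rect_int f a b c d = (rect_int f a m c d + rect_int f m b c d)%C.
Proof.
intros [Ham Hmb] Hcd H1 H2.
destruct (rect_boundary_integrable_sides f a m c d) as [L1 [L2 [L3 L4]]]; auto.
destruct (rect_boundary_integrable_sides f m b c d) as [R1 [R2 [R3 R4]]]; auto.
rewrite !rect_int_sides; auto; try lra.
- rewrite (seg_int_Chasles (fun x => f (x, c)) a m b) //.
  rewrite (seg_int_Chasles (fun x => f (x, d)) a m b) //; ring.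
- intros w [[Hx Hy]|[[Hx|Hx] Hy]].
  + destruct (Rle_dec (fst w) m); [apply H1 | apply H2]; left; split; auto; lra.
  + apply H1; right; auto.
  + apply H2; right; auto.
Qed.

Lemma rect_int_split_v (f : C -> C) (a b c m d : R) :
  a <= b -> c <= m <= d ->
  (forall w, on_rect_boundary a b c m w -> cdiffable f w) ->
  (forall w, on_rect_boundary a b m d w -> cdiffable f w) ->
  rect_int f a b c d = (rect_int f a b c m + rect_int f a b m d)%C.
Proof.
intros Hab [Ham Hmb] H1 H2.
destruct (rect_boundary_integrable_sides f a b c m) as [L1 [L2 [L3 L4]]]; auto.
destruct (rect_boundary_integrable_sides f a b m d) as [R1 [R2 [R3 R4]]]; auto.
rewrite !rect_int_sides; auto; try lra.
- rewrite (seg_int_Chasles (fun y => f (a, y)) c m d) //.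
  rewrite (seg_int_Chasles (fun y => f (b, y)) c m d) //; ring.
- intros w [[Hx [Hy|Hy]]|[Hx Hy]].
  + apply H1; left; auto.
  + apply H2; left; auto.
  + destruct (Rle_dec (snd w) m); [apply H1 | apply H2]; right; split; auto; lra.
Qed.

(** * Goursat's theorem and Cauchy's formula *)

(* A bad rectangle has a bad quarter; iterating, bad rectangles of scale
   [2^-n] shrink to a point [(p, q)], which contradicts the local hypothesis. *)
Lemma rect_bisection (P : R -> R -> R -> Prop) (u v : R) :
  0 < u -> 0 < v ->
  (forall x y s, 0 < s ->
    P x y (s / 2) -> P (x + s / 2 * u) y (s / 2) ->
    P x (y + s / 2 * v) (s / 2) -> P (x + s / 2 * u) (y + s / 2 * v) (s / 2) ->
    P x y s) ->
  (forall p q, exists delta, 0 < delta /\ forall x y s, 0 < s < delta ->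
    x <= p <= x + s * u -> y <= q <= y + s * v -> P x y s) ->
  forall x y, P x y 1.
Proof.
intros Hu Hv Hquart Hloc x0 y0; apply NNPP; intros Hbad.
set (T := {r : R * R * R | 0 < snd r /\ ~ P (fst (fst r)) (snd (fst r)) (snd r)}).
(* If no quarter were bad, all four would satisfy [P], and so would the whole. Choice turns the bad
   quarter into a function that can be iterated. *)
assert (step : forall t : T, {t' : T |
  let '(x, y, s) := proj1_sig t in let '(x', y', s') := proj1_sig t' in
  s' = s / 2 /\ x <= x' <= x + s / 2 * u /\ y <= y' <= y + s / 2 * v}).
{ intros [[[x y] s] [Hs Hb]]; simpl in Hs, Hb; apply constructive_indefinite_description.
  assert (Hs2 : 0 < s / 2) by lra.
  assert (Hu2 : 0 < s / 2 * u) by nra.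
  assert (Hv2 : 0 < s / 2 * v) by nra.
  assert (K : forall x' y', ~ P x' y' (s / 2) ->
    x <= x' <= x + s / 2 * u /\ y <= y' <= y + s / 2 * v -> exists t' : T,
    let '(x', y', s') := proj1_sig t' in
    s' = s / 2 /\ x <= x' <= x + s / 2 * u /\ y <= y' <= y + s / 2 * v).
  { intros x' y' Hb' Hx'.
    exists (exist _ (x', y', s / 2) (conj Hs2 Hb')); simpl; tauto. }
  apply NNPP; intros Hno.
  apply Hb, Hquart; auto; apply NNPP; intros Hb'; apply Hno, (K _ _ Hb'); lra. }
set (seq := nat_rect (fun _ => T) (exist _ (x0, y0, 1) (conj Rlt_0_1 Hbad))
  (fun _ t => proj1_sig (step t))).
set (xs n := fst (fst (proj1_sig (seq n)))).
set (ys n := snd (fst (proj1_sig (seq n)))).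
set (ss n := snd (proj1_sig (seq n))).
assert (Hstep : forall n, ss (S n) = ss n / 2 /\
  xs n <= xs (S n) <= xs n + ss n / 2 * u /\ ys n <= ys (S n) <= ys n + ss n / 2 * v).
{ intros n; unfold xs, ys, ss; simpl.
  generalize (proj2_sig (step (seq n))).
  destruct (proj1_sig (step (seq n))) as [[[x' y'] s'] H'].
  destruct (seq n) as [[[x y] s] H]; simpl; auto. }
assert (Hss : forall n, ss n = (/ 2) ^ n).
{ induction n as [|n IH]; [reflexivity|].
  rewrite (proj1 (Hstep n)) IH; simpl; field. }
assert (Hpos : forall n, 0 < ss n) by (intros n; rewrite Hss; apply pow_lt; lra).
(* Nested intervals: left ends increase, right ends decrease, and the supremum of the left ends lies
   in every interval. *)
assert (lim : forall zs w, 0 < w ->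
  (forall n, zs n <= zs (S n) <= zs n + ss n / 2 * w) ->
  exists p, forall n, zs n <= p <= zs n + ss n * w).
{ intros zs w Hw Hz.
  assert (mono : forall n k, zs n <= zs (n + k)%nat /\
    zs (n + k)%nat + ss (n + k)%nat * w <= zs n + ss n * w).
  { intros n; induction k as [|k IH].
    - rewrite Nat.add_0_r; lra.
    - rewrite Nat.add_succ_r; destruct (Hstep (n + k)%nat) as [E _].
      rewrite E; specialize (Hz (n + k)%nat); nra. }
  assert (up : forall n m, zs m <= zs n + ss n * w).
  { intros n m; destruct (mono n m) as [_ H1]; destruct (mono m n) as [H2 _].
    rewrite Nat.add_comm in H2; specialize (Hpos (n + m)%nat); nra. }
  destruct (completeness (fun z => exists n, z = zs n)) as [p [Hp1 Hp2]].
  - exists (zs O + ss O * w); intros z [n ->]; apply up.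
  - now exists (zs O), O.
  - exists p; intros n; split; [apply Hp1; now exists n|].
    apply Hp2; intros z [m ->]; apply up. }
destruct (lim xs u Hu) as [p Hp]; [intros n; apply Hstep|].
destruct (lim ys v Hv) as [q Hq]; [intros n; apply Hstep|].
destruct (Hloc p q) as [delta [Hd HP]].
destruct (pow_lt_1_zero (/ 2)) with (y := delta) as [N HN];
  [rewrite Rabs_pos_eq; lra | exact Hd |].
apply (proj2 (proj2_sig (seq N))), (HP (xs N) (ys N) (ss N)); auto.
split; auto.
rewrite Hss; apply Rle_lt_trans with (1 := Rle_abs _), HN; lia.
Qed.

(** The diameter is bounded by the sum of the two side lengths, the quantity that also occurs in
    [rect_int_le]. *)
Lemma Cmod_in_rect (a b c d : R) (w z : C) :
  in_rect a b c d w -> in_rect a b c d z -> Cmod (w - z) <= (b - a) + (d - c).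
Proof.
destruct w as [x y], z as [x' y']; intros [Hx Hy] [Hx' Hy']; simpl in *.
replace ((x, y) - (x', y'))%C with (RtoC (x - x') + RtoC (y - y') * Ci)%C
  by (apply injective_projections; simpl; ring).
apply Rle_trans with (1 := Cmod_triangle _ _); rewrite Cmod_mult !Cmod_R Cmod_Ci.
assert (Rabs (x - x') <= b - a) by (apply Rabs_le; lra).
assert (Rabs (y - y') <= d - c) by (apply Rabs_le; lra); lra.
Qed.

Lemma on_boundary_in_rect (a b c d : R) (w : C) :
  a <= b -> c <= d -> on_rect_boundary a b c d w -> in_rect a b c d w.
Proof. intros Hab Hcd [[Hx [Hy|Hy]]|[[Hx|Hx] Hy]]; split; lra. Qed.

(** Near a point, [f] is affine up to a small multiple of the distance. The affine part integrates
    to 0, so on a rectangle of scale s the integral is at most eps s^2. Such bounds add up exactly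
    over the four quarters, and bisection carries them to the whole rectangle. *)
Lemma goursat (f : C -> C) (a b c d : R) :
  a < b -> c < d ->
  (forall w, in_rect a b c d w -> cdiffable f w) -> rect_int f a b c d = 0.
Proof.
intros Hab Hcd Hf.
assert (Hf' : forall a' b' c' d', a <= a' -> a' <= b' -> b' <= b ->
  c <= c' -> c' <= d' -> d' <= d ->
  forall w, on_rect_boundary a' b' c' d' w -> cdiffable f w).
{ intros a' b' c' d' Ha Hab' Hb Hc Hcd' Hd w Hw; apply Hf.
  apply on_boundary_in_rect in Hw; auto; destruct Hw; split; lra. }
set (u := b - a); set (v := d - c).
assert (Hu : 0 < u) by (unfold u; lra).
assert (Hv : 0 < v) by (unfold v; lra).
apply Cmod_eq_0, Rle_antisym; [|apply Cmod_ge_0].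
apply le_epsilon; intros eps Heps; rewrite Rplus_0_l.
set (P x y s := a <= x -> x + s * u <= b -> c <= y -> y + s * v <= d ->
  Cmod (rect_int f x (x + s * u) y (y + s * v)) <= eps * s ^ 2).
assert (HP : P a c 1).
2:{ unfold P, u, v in HP.
  replace (a + 1 * (b - a)) with b in HP by ring.
  replace (c + 1 * (d - c)) with d in HP by ring.
  replace (eps * 1 ^ 2) with eps in HP by ring; apply HP; lra. }
apply rect_bisection with u v; auto.
- intros x y s Hs P1 P2 P3 P4 Hx1 Hx2 Hy1 Hy2.
  assert (Hsu : 0 < s / 2 * u) by nra.
  assert (Hsv : 0 < s / 2 * v) by nra.
  unfold P in P1, P2, P3, P4.
  replace (x + s / 2 * u + s / 2 * u) with (x + s * u) in P2, P4 by field.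
  replace (y + s / 2 * v + s / 2 * v) with (y + s * v) in P3, P4 by field.
  rewrite (rect_int_split_h f x (x + s / 2 * u)); try (apply Hf'); try lra.
  rewrite (rect_int_split_v f x (x + s / 2 * u) y (y + s / 2 * v)); try (apply Hf'); try lra.
  rewrite (rect_int_split_v f _ (x + s * u) y (y + s / 2 * v)); try (apply Hf'); try lra.
  assert (T := Cmod_triangle).
  apply Rle_trans with (1 := T _ _).
  apply Rle_trans with (1 := Rplus_le_compat _ _ _ _ (T _ _) (T _ _)).
  assert (K1 := P1 ltac:(lra) ltac:(lra) ltac:(lra) ltac:(lra)).
  assert (K2 := P2 ltac:(lra) ltac:(lra) ltac:(lra) ltac:(lra)).
  assert (K3 := P3 ltac:(lra) ltac:(lra) ltac:(lra) ltac:(lra)).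
  assert (K4 := P4 ltac:(lra) ltac:(lra) ltac:(lra) ltac:(lra)).
  replace (eps * (s / 2) ^ 2) with (eps * s ^ 2 / 4) in K1, K2, K3, K4 by field.
  lra.
- intros p q.
  destruct (classic (in_rect a b c d (p, q))) as [Hz|Hz].
  (* A point outside the rectangle lies in no admissible subrectangle, so [P] holds vacuously. *)
  2:{ exists 1; split; [lra|].
    intros x y s [Hs _] Hp Hq Hx1 Hx2 Hy1 Hy2; exfalso; apply Hz; split; simpl; lra. }
  destruct (Hf _ Hz) as [l Hl].
  set (k := u + v); assert (Hk : 0 < k) by (unfold k; lra).
  (* The sides of a subrectangle of scale s add up to s k, so [rect_int_le] gives 4 (s k) (eps / (4
     k^2)) (s k) = eps s^2. *)
  destruct (Hl (eps / (4 * k ^ 2))) as [del [Hdel Hlin]].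
  { apply Rdiv_lt_0_compat; nra. }
  exists (del / k); split; [now apply Rdiv_lt_0_compat|].
  intros x y s [Hs Hsd] Hp Hq Hx1 Hx2 Hy1 Hy2.
  assert (Hsk : s * k < del) by (apply Rlt_div_r; auto).
  assert (Hsu : 0 < s * u) by nra.
  assert (Hsv : 0 < s * v) by nra.
  set (A := (f (p, q) - (p, q) * l)%C).
  assert (E := rect_int_lin f (fun w => A + w * l)%C (- (1)) x (x + s * u) y (y + s * v)).
  rewrite rect_int_affine in E.
  assert (Haff : forall w, cdiffable (fun w => A + w * l)%C w).
  { intros w; apply cdiffable_plus; [apply cdiffable_const|].
    apply cdiffable_mult; [apply cdiffable_id | apply cdiffable_const]. }
  assert (Hb : forall w, on_rect_boundary x (x + s * u) y (y + s * v) w -> cdiffable f w)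
    by (apply Hf'; lra).
  replace (rect_int f _ _ _ _) with
    (rect_int f x (x + s * u) y (y + s * v) + - (1) * 0)%C by ring.
  rewrite -E; auto; try lra.
  replace (eps * s ^ 2) with (4 * ((x + s * u - x) + (y + s * v - y)) *
    (eps / (4 * k ^ 2) * (s * k))) by (unfold k; field; unfold k in Hk; lra).
  apply rect_int_le; try lra.
  + intros w Hw; apply cdiffable_plus; auto.
    apply cdiffable_mult; [apply cdiffable_const | auto].
  + intros w Hw; apply on_boundary_in_rect in Hw; try lra.
    assert (Hd : Cmod (w - (p, q)) <= s * k).
    { replace (s * k) with ((x + s * u - x) + (y + s * v - y)) by (unfold k; ring).
      apply Cmod_in_rect; auto; split; simpl; lra. }
    replace (f w + - (1) * (A + w * l))%C with (f w - f (p, q) - (w - (p, q)) * l)%C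
      by (unfold A; ring).
    apply Rle_trans with (1 := Hlin w (Rle_lt_trans _ _ _ Hd Hsk)).
    apply Rmult_le_compat_l; [|exact Hd].
    left; apply Rdiv_lt_0_compat; nra.
Qed.

(* Around [z] only boundedness is needed: the rectangle is cut into a small
   square around [z] and four rectangles avoiding [z]. *)
Lemma goursat_punctured (g : C -> C) (a b c d M r : R) (z : C) :
  a < fst z < b -> c < snd z < d -> 0 < r ->
  (forall w, in_rect a b c d w -> w <> z -> cdiffable g w) ->
  (forall w, Cmod (w - z) < r -> w <> z -> Cmod (g w) <= M) ->
  rect_int g a b c d = 0.
Proof.
destruct z as [x y]; simpl; intros Hx Hy Hr Hg HM.
assert (HM0 : 0 <= M).
{ apply Rle_trans with (1 := Cmod_ge_0 (g (x + r / 2, y)%R)), HM.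
  - replace (((x + r / 2, y)%R : C) - (x, y))%C with (RtoC (r / 2))
      by (apply injective_projections; simpl; ring).
    rewrite Cmod_R Rabs_pos_eq; lra.
  - intros E; apply (f_equal fst) in E; simpl in E; lra. }
apply Cmod_eq_0, Rle_antisym; [|apply Cmod_ge_0].
apply le_epsilon; intros eps Heps; rewrite Rplus_0_l.
(* [e] is half the side of the small square: 4 e bounds its diameter, and 16 e M is the estimate of
   [rect_int_le] on it. *)
assert (He : exists e, 0 < e /\ a < x - e /\ x + e < b /\ c < y - e /\ y + e < d /\
  4 * e < r /\ 16 * e * M <= eps).
{ set (e1 := Rmin (Rmin (x - a) (b - x)) (Rmin (y - c) (d - y))).
  set (e2 := Rmin (r / 5) (eps / (16 * (M + 1)))).
  assert (H1 := Rmin_l (Rmin (x - a) (b - x)) (Rmin (y - c) (d - y))).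
  assert (H2 := Rmin_r (Rmin (x - a) (b - x)) (Rmin (y - c) (d - y))).
  assert (H3 := Rmin_l (x - a) (b - x)); assert (H4 := Rmin_r (x - a) (b - x)).
  assert (H5 := Rmin_l (y - c) (d - y)); assert (H6 := Rmin_r (y - c) (d - y)).
  assert (H7 := Rmin_l (r / 5) (eps / (16 * (M + 1)))).
  assert (H8 := Rmin_r (r / 5) (eps / (16 * (M + 1)))).
  assert (H9 := Rmin_l e1 e2); assert (H10 := Rmin_r e1 e2).
  fold e1 in H1, H2; fold e2 in H7, H8.
  assert (P : 0 < Rmin e1 e2).
  { unfold e1, e2; repeat apply Rmin_pos; try lra; apply Rdiv_lt_0_compat; lra. }
  assert (Q : eps / (16 * (M + 1)) * (16 * (M + 1)) = eps) by (field; lra).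
  exists (Rmin e1 e2 / 2); repeat split; try lra; nra. }
destruct He as [e [He [Ha [Hb [Hc [Hd [Her HeM]]]]]]].
assert (Hbd : forall a' b' c' d', a <= a' -> a' <= b' -> b' <= b ->
  c <= c' -> c' <= d' -> d' <= d ->
  x <> a' -> x <> b' -> y <> c' -> y <> d' ->
  forall w, on_rect_boundary a' b' c' d' w -> cdiffable g w).
{ intros a' b' c' d' Ha' Hab' Hb' Hc' Hcd' Hd' N1 N2 N3 N4 w Hw.
  assert (Hwr := on_boundary_in_rect _ _ _ _ _ Hab' Hcd' Hw); apply Hg.
  - destruct Hwr; split; lra.
  - intros ->; destruct Hw as [[_ [K|K]]|[[K|K] _]]; simpl in K; auto. }
assert (Hz : forall a' b' c' d', a <= a' -> a' < b' -> b' <= b ->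
  c <= c' -> c' < d' -> d' <= d ->
  (x < a' \/ b' < x \/ y < c' \/ d' < y) -> rect_int g a' b' c' d' = 0).
{ intros a' b' c' d' Ha' Hab' Hb' Hc' Hcd' Hd' N; apply goursat; auto.
  intros w [Hw1 Hw2]; apply Hg; [split; lra|].
  intros ->; simpl in Hw1, Hw2; lra. }
assert (Hin : forall w, on_rect_boundary (x - e) (x + e) (y - e) (y + e) w ->
  cdiffable g w) by (apply Hbd; lra).
rewrite (rect_int_split_h g a (x - e)); try (apply Hbd); try lra.
rewrite (rect_int_split_h g (x - e) (x + e) b); try (apply Hbd); try lra.
rewrite (rect_int_split_v g (x - e) (x + e) c (y - e)); try (apply Hbd); try lra.
rewrite (rect_int_split_v g (x - e) (x + e) (y - e) (y + e)); try (apply Hbd); try lra.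
rewrite (Hz a (x - e)); try lra.
rewrite (Hz (x + e) b); try lra.
rewrite (Hz (x - e) (x + e) c (y - e)); try lra.
rewrite (Hz (x - e) (x + e) (y + e) d); try lra.
replace (0 + _)%C with (rect_int g (x - e) (x + e) (y - e) (y + e)) by ring.
apply Rle_trans with (2 := HeM).
replace (16 * e * M) with (4 * ((x + e - (x - e)) + (y + e - (y - e))) * M) by ring.
apply rect_int_le; try lra; auto.
intros w Hw; apply HM.
- apply on_boundary_in_rect in Hw; try lra.
  apply Rle_lt_trans with (1 := Cmod_in_rect _ _ _ _ _ (x, y) Hw ltac:(split; simpl; lra)).
  lra.
- intros ->; destruct Hw as [[_ [K|K]]|[[K|K] _]]; simpl in K; lra.
Qed.

(** Classically 2 pi i times the winding number of the boundary around [z]. *)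
Definition winding (a b c d : R) (z : C) : C :=
  rect_int (fun w => / (w - z))%C a b c d.

Lemma cdiffable_kernel (z w : C) : w <> z -> cdiffable (fun w => / (w - z))%C w.
Proof.
intros Hw; apply cdiffable_inv.
- apply cdiffable_minus; [apply cdiffable_id | apply cdiffable_const].
- intros E; apply Hw; replace w with (w - z + z)%C by ring; rewrite E; ring.
Qed.

(** The difference quotient (f(w) - f(z)) / (w - z) is differentiable away from z and bounded near
    z, so its integral vanishes by [goursat_punctured]; linearity separates the two terms. *)
Lemma cauchy_formula (f : C -> C) (a b c d : R) (z : C) :
  a < fst z < b -> c < snd z < d ->
  (forall w, in_rect a b c d w -> cdiffable f w) ->
  rect_int (fun w => f w * / (w - z))%C a b c d = (f z * winding a b c d z)%C.
Proof.
intros Hx Hy Hf.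
assert (Hz : cdiffable f z) by (apply Hf; split; lra).
destruct Hz as [l Hl].
destruct (Hl 1 Rlt_0_1) as [r [Hr Hb]].
assert (Hk : forall w, in_rect a b c d w -> w <> z ->
  cdiffable (fun w => f w * / (w - z))%C w).
{ intros w Hw Hwz; apply cdiffable_mult; auto using cdiffable_kernel. }
assert (Hk2 : forall w, in_rect a b c d w -> w <> z ->
  cdiffable (fun w => f w * / (w - z) + - f z * / (w - z))%C w).
{ intros w Hw Hwz; apply cdiffable_plus; auto.
  apply cdiffable_mult; auto using cdiffable_const, cdiffable_kernel. }
assert (Hbd : forall w, on_rect_boundary a b c d w -> in_rect a b c d w /\ w <> z).
{ intros w Hw; split; [apply on_boundary_in_rect in Hw; auto; lra|].
  intros ->; destruct Hw as [[_ [K|K]]|[[K|K] _]]; lra. }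
assert (G := goursat_punctured _ a b c d (1 + Cmod l) r z Hx Hy Hr Hk2).
rewrite rect_int_lin in G; try lra.
- unfold winding; replace (f z * _)%C with
    (0 + f z * rect_int (fun w => / (w - z)) a b c d)%C by ring.
  rewrite -G; [ring|].
  intros w Hw Hwz.
  assert (Hwz' : (w - z)%C <> 0).
  { intros E; apply Hwz; replace w with (w - z + z)%C by ring; rewrite E; ring. }
  replace (f w * / (w - z) + - f z * / (w - z))%C
    with ((f w - f z - (w - z) * l) * / (w - z) + l)%C by (field; auto).
  apply Rle_trans with (1 := Cmod_triangle _ _), Rplus_le_compat_r.
  rewrite Cmod_mult Cmod_inv //.
  assert (Hp := proj1 (Cmod_gt_0 _) Hwz').
  apply Rle_div_l; [exact Hp|]; apply Hb, Hw.
- intros w Hw; apply Hbd in Hw; apply Hk; apply Hw.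
- intros w Hw; apply Hbd in Hw; apply cdiffable_kernel, Hw.
Qed.

(** * Differentiability of the derivative *)

(* Along each side, traversed counterclockwise, the imaginary part of
   [dw / (w - z)] is positive. *)
Lemma winding_neq_0 (a b c d : R) (z : C) :
  a < fst z < b -> c < snd z < d -> winding a b c d z <> 0.
Proof.
intros Hx Hy E; apply (f_equal snd) in E; revert E.
unfold winding, rect_int; simpl.
(* The factor [Ci] makes the real part of the vertical integral count, so there it is Re 1 / (w - z)
   whose sign matters. *)
rewrite Rmult_0_l Rplus_0_l Rmult_1_l.
match goal with |- ?I1 + ?I2 = _ -> _ => enough (0 < I1 /\ 0 < I2) by lra end.
assert (Hne : forall w, (fst w <> fst z \/ snd w <> snd z) ->
  cdiffable (fun w => / (w - z))%C w).
{ intros w Hw; apply cdiffable_kernel; intros ->; tauto. }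
assert (Hsq : forall x y, x <> 0 -> 0 < x ^ 2 + y ^ 2).
{ intros x y H0; assert (0 < x ^ 2) by (apply pow2_gt_0; lra); nra. }
split; apply RInt_gt_0; try lra; intros t Ht.
- simpl; rewrite /Rdiv.
  assert (P1 : 0 < / ((t + - fst z) ^ 2 + (c + - snd z) ^ 2)).
  { apply Rinv_0_lt_compat; rewrite Rplus_comm; apply Hsq; lra. }
  assert (P2 : 0 < / ((t + - fst z) ^ 2 + (d + - snd z) ^ 2)).
  { apply Rinv_0_lt_compat; rewrite Rplus_comm; apply Hsq; lra. }
  simpl in P1, P2; nra.
- apply: continuous_minus;
    apply (cdiffable_line_continuous (fun w => / (w - z))%C (fun x => (x, _)));
    try (intros s; apply Cmod_h); apply Hne; right; simpl; lra.
- simpl; rewrite /Rdiv.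
  assert (P1 : 0 < / ((a + - fst z) ^ 2 + (t + - snd z) ^ 2)).
  { apply Rinv_0_lt_compat; apply Hsq; lra. }
  assert (P2 : 0 < / ((b + - fst z) ^ 2 + (t + - snd z) ^ 2)).
  { apply Rinv_0_lt_compat; apply Hsq; lra. }
  simpl in P1, P2; nra.
- apply: continuous_minus;
    apply (cdiffable_line_continuous (fun w => / (w - z))%C (fun x => (_, x)));
    try (intros s; apply Cmod_v); apply Hne; left; simpl; lra.
Qed.

(** Differentiation under the integral sign: the quadratic remainder of the kernel is uniform along
    the boundary, hence survives integration with a constant factor. *)
Lemma cdiff_rect_int_param (f : C -> C) (k k' : C -> C -> C) (a b c d r K M : R) (z : C) :
  a <= b -> c <= d -> 0 < r ->
  (forall w, on_rect_boundary a b c d w -> cdiffable f w) ->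
  (forall w, on_rect_boundary a b c d w -> Cmod (f w) <= M) ->
  (forall w, on_rect_boundary a b c d w -> cdiffable (k' z) w) ->
  (forall v w, Cmod (v - z) < r -> on_rect_boundary a b c d w ->
    cdiffable (k v) w /\
    Cmod (k v w - k z w - (v - z) * k' z w) <= K * Cmod (v - z) ^ 2) ->
  cdiff (fun v => rect_int (fun w => f w * k v w)%C a b c d) z
    (rect_int (fun w => f w * k' z w)%C a b c d).
Proof.
intros Hab Hcd Hr Hf HM Hk' Hk eps Heps.
set (B := 4 * ((b - a) + (d - c)) * (Rabs M * Rabs K)).
assert (HB : 0 <= B).
{ unfold B; assert (H1 := Rabs_pos M); assert (H2 := Rabs_pos K).
  apply Rmult_le_pos; nra. }
exists (Rmin r (eps / (B + 1))); split.
{ apply Rmin_pos; auto; apply Rdiv_lt_0_compat; lra. }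
intros v Hv.
assert (Hv1 := Rlt_le_trans _ _ _ Hv (Rmin_l _ _)).
assert (Hv2 : Cmod (v - z) * (B + 1) < eps).
{ apply Rlt_div_r; [lra|]; apply Rlt_le_trans with (1 := Hv), Rmin_r. }
assert (Hz : Cmod (z - z) < r).
{ replace (z - z)%C with (RtoC 0) by ring; now rewrite Cmod_0. }
assert (D1 : forall w, on_rect_boundary a b c d w -> cdiffable (fun w => f w * k v w)%C w).
{ intros w Hw; apply cdiffable_mult; auto; now apply Hk. }
assert (D2 : forall w, on_rect_boundary a b c d w -> cdiffable (fun w => f w * k z w)%C w).
{ intros w Hw; apply cdiffable_mult; auto; now apply Hk. }
assert (D3 : forall w, on_rect_boundary a b c d w -> cdiffable (fun w => f w * k' z w)%C w).
{ intros w Hw; apply cdiffable_mult; auto. }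
assert (D4 : forall w, on_rect_boundary a b c d w ->
  cdiffable (fun w => f w * k v w + - (1) * (f w * k z w))%C w).
{ intros w Hw; apply cdiffable_plus; auto; apply cdiffable_mult; auto using cdiffable_const. }
replace (_ - _ - _)%C with (rect_int (fun w => (f w * k v w + - (1) * (f w * k z w)) +
  - (v - z) * (f w * k' z w))%C a b c d).
2:{ rewrite rect_int_lin // rect_int_lin //; ring. }
apply Rle_trans with (B * Cmod (v - z) ^ 2).
- unfold B; rewrite Rmult_assoc; apply rect_int_le; auto.
  + intros w Hw; apply cdiffable_plus; auto.
    apply cdiffable_mult; auto using cdiffable_const.
  + intros w Hw.
    replace (_ + _)%C with (f w * (k v w - k z w - (v - z) * k' z w))%C by ring.
    rewrite Cmod_mult Rmult_assoc; apply Rmult_le_compat; try apply Cmod_ge_0.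
    * apply Rle_trans with (2 := Rle_abs _); auto.
    * apply Rle_trans with (1 := proj2 (Hk v w Hv1 Hw)).
      apply Rmult_le_compat_r; [apply pow2_ge_0 | apply Rle_abs].
- assert (H0 := Cmod_ge_0 (v - z)); nra.
Qed.

(** The remainder is e^2 / (u^2 (u + e)) times the sum 2 / u + 1 / (u + e), whence the factor 3. *)
Lemma Cinv_sqr_taylor1 (u e : C) (r : R) :
  0 < r -> r <= Cmod u -> r <= Cmod (u + e) ->
  Cmod (/ (u + e) * / (u + e) - / u * / u - e * (- (2) * (/ u * / u * / u))) <=
    3 * (/ r) ^ 4 * Cmod e ^ 2.
Proof.
intros Hr Hu Hue.
assert (Hu0 : u <> 0) by (intros ->; rewrite Cmod_0 in Hu; lra).
assert (He0 : (u + e)%C <> 0) by (intros E; rewrite E Cmod_0 in Hue; lra).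
replace (_ - _ - _)%C
  with (e * e * (/ u * / u * (/ (u + e) * (/ u + / u + / (u + e)))))%C by (field; auto).
assert (I : forall x : C, x <> 0 -> r <= Cmod x -> 0 <= Cmod (/ x) <= / r).
{ intros x Hx Hrx; split; [apply Cmod_ge_0|].
  rewrite Cmod_inv //; apply Rinv_le_contravar; lra. }
apply I in Hu; auto; apply I in Hue; auto.
assert (S : Cmod (/ u + / u + / (u + e)) <= 3 * / r).
{ apply Rle_trans with (1 := Cmod_triangle _ _).
  apply Rle_trans with (1 := Rplus_le_compat_r _ _ _ (Cmod_triangle _ _)); lra. }
rewrite !Cmod_mult.
replace (3 * (/ r) ^ 4 * Cmod e ^ 2)
  with (Cmod e * Cmod e * (/ r * / r * (/ r * (3 * / r)))) by ring.
assert (H0 := Cmod_ge_0).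
apply Rmult_le_compat_l; [apply Rmult_le_pos; apply H0|].
repeat (apply Rmult_le_compat; try (repeat apply Rmult_le_pos); try apply H0; try lra).
Qed.

(** Near [z0], Cauchy's formula makes [f] a quotient of two parameter integrals. The quotient rule
    expresses [C_derive f] through integrals that can be differentiated once more. *)
Lemma cdiffable_C_derive (f : C -> C) (z0 : C) (R0 : R) :
  0 < R0 -> (forall w, Cmod (w - z0) < R0 -> cdiffable f w) ->
  cdiffable (C_derive f) z0.
Proof.
intros HR0 Hf0.
destruct (cdiffable_continuous f z0) with (eps := 1) as [R1 [HR1 Hcont]].
{ apply Hf0; replace (z0 - z0)%C with (RtoC 0) by ring; now rewrite Cmod_0. }
{ lra. }
set (M := Cmod (f z0) + 1).
(* The square has half-side 2 r. Its side lengths add up to 8 r, less than 10 r, so it stays where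
   [f] is controlled, while points within r of the centre keep distance at least r from its
   boundary. *)
set (r := Rmin R0 R1 / 10).
assert (Hr : 0 < r) by (unfold r; assert (P := Rmin_pos _ _ HR0 HR1); lra).
destruct z0 as [x0 y0].
set (a := x0 - 2 * r); set (b := x0 + 2 * r); set (c := y0 - 2 * r); set (d := y0 + 2 * r).
assert (Hz0 : in_rect a b c d (x0, y0)) by (unfold a, b, c, d; split; simpl; lra).
assert (Hin : forall w, in_rect a b c d w -> Cmod (w - (x0, y0)) < Rmin R0 R1).
{ intros w Hw; apply Rle_lt_trans with (1 := Cmod_in_rect _ _ _ _ _ _ Hw Hz0).
  unfold a, b, c, d, r; assert (P := Rmin_pos _ _ HR0 HR1); lra. }
assert (Hab : a <= b) by (unfold a, b; lra).
assert (Hcd : c <= d) by (unfold c, d; lra).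
assert (Hf : forall w, in_rect a b c d w -> cdiffable f w).
{ intros w Hw; apply Hf0, Rlt_le_trans with (1 := Hin w Hw), Rmin_l. }
assert (HM : forall w, in_rect a b c d w -> Cmod (f w) <= M).
{ intros w Hw; unfold M.
  replace (f w) with (f (x0, y0) + (f w - f (x0, y0)))%C by ring.
  apply Rle_trans with (1 := Cmod_triangle _ _), Rplus_le_compat_l, Rlt_le.
  apply Hcont, Rlt_le_trans with (1 := Hin w Hw), Rmin_r. }
assert (Hbd : forall w, on_rect_boundary a b c d w -> in_rect a b c d w).
{ intros w; apply on_boundary_in_rect; auto. }
assert (Hball : forall v, Cmod (v - (x0, y0)) < r ->
  Rabs (fst v - x0) < r /\ Rabs (snd v - y0) < r).
{ intros v Hv; assert (P := Rle_lt_trans _ _ _ (Rmax_Cmod _) Hv).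
  apply Rmax_Rlt in P; exact P. }
assert (Hfar : forall v w, Cmod (v - (x0, y0)) < r -> on_rect_boundary a b c d w ->
  r <= Cmod (w - v)).
{ intros v w Hv Hw; apply Hball in Hv; destruct Hv as [Hv1 Hv2].
  apply Rabs_def2 in Hv1; apply Rabs_def2 in Hv2.
  apply Rle_trans with (2 := Rmax_Cmod _); simpl; apply Rmax_Rle.
  unfold a, b, c, d in Hw; unfold Rabs.
  destruct Hw as [[_ [E|E]]|[[E|E] _]]; rewrite E; repeat destruct Rcase_abs; lra. }
assert (Hne : forall v w, Cmod (v - (x0, y0)) < r -> on_rect_boundary a b c d w -> w <> v).
{ intros v w Hv Hw ->; apply (Hfar v v Hv) in Hw.
  replace (v - v)%C with (RtoC 0) in Hw by ring; rewrite Cmod_0 in Hw; lra. }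
(* Each kernel is the derivative of the previous one with respect to [v]. *)
pose (k1 := fun v w : C => (/ (w - v))%C).
pose (k2 := fun v w : C => (/ (w - v) * / (w - v))%C).
pose (k3 := fun v w : C => (2 * (/ (w - v) * / (w - v) * / (w - v)))%C).
assert (Hk1 : forall v w, Cmod (v - (x0, y0)) < r -> on_rect_boundary a b c d w ->
  cdiffable (k1 v) w) by (intros; apply cdiffable_kernel; auto).
assert (Hk2 : forall v w, Cmod (v - (x0, y0)) < r -> on_rect_boundary a b c d w ->
  cdiffable (k2 v) w) by (intros; apply cdiffable_mult; apply Hk1; auto).
assert (Hk3 : forall v w, Cmod (v - (x0, y0)) < r -> on_rect_boundary a b c d w ->
  cdiffable (k3 v) w).
{ intros; apply cdiffable_mult; [apply cdiffable_const|].
  apply cdiffable_mult; [apply Hk2 | apply Hk1]; auto. }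
assert (Hsub : forall v, Cmod (v - (x0, y0)) < r -> exists r', 0 < r' /\
  forall v', Cmod (v' - v) < r' -> Cmod (v' - (x0, y0)) < r).
{ intros v Hv; exists (r - Cmod (v - (x0, y0))); split; [lra|]; intros v' Hv'.
  replace (v' - (x0, y0))%C with ((v' - v) + (v - (x0, y0)))%C by ring.
  apply Rle_lt_trans with (1 := Cmod_triangle _ _); lra. }
assert (J1 : forall g N v, (forall w, in_rect a b c d w -> cdiffable g w) ->
  (forall w, in_rect a b c d w -> Cmod (g w) <= N) -> Cmod (v - (x0, y0)) < r ->
  cdiff (fun v => rect_int (fun w => g w * k1 v w)%C a b c d) v
    (rect_int (fun w => g w * k2 v w)%C a b c d)).
{ intros g N v Hg HN Hv; destruct (Hsub v Hv) as [r' [Hr' Hs]].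
  apply (cdiff_rect_int_param g k1 k2 a b c d r' ((/ r) ^ 3) N); auto.
  intros v' w Hv' Hw; split; auto.
  (* Moving the parameter from v to v' changes w - v by -(v' - v). *)
  assert (T := Cinv_taylor1 (w - v) (- (v' - v)) r Hr).
  replace (w - v + - (v' - v))%C with (w - v')%C in T by ring.
  rewrite Cmod_opp in T; unfold k1, k2.
  replace (/ (w - v) * / (w - v))%C with (/ ((w - v) * (w - v)))%C.
  - replace (_ - (v' - v) * _)%C with
      (/ (w - v') - / (w - v) - - (v' - v) * - / ((w - v) * (w - v)))%C by ring.
    apply T; auto.
  - field.
    assert (P := Hfar v w Hv Hw); intros E; rewrite E Cmod_0 in P; lra. }
assert (J2 : forall g N v, (forall w, in_rect a b c d w -> cdiffable g w) ->
  (forall w, in_rect a b c d w -> Cmod (g w) <= N) -> Cmod (v - (x0, y0)) < r ->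
  cdiff (fun v => rect_int (fun w => g w * k2 v w)%C a b c d) v
    (rect_int (fun w => g w * k3 v w)%C a b c d)).
{ intros g N v Hg HN Hv; destruct (Hsub v Hv) as [r' [Hr' Hs]].
  apply (cdiff_rect_int_param g k2 k3 a b c d r' (3 * (/ r) ^ 4) N); auto.
  intros v' w Hv' Hw; split; auto.
  assert (T := Cinv_sqr_taylor1 (w - v) (- (v' - v)) r Hr).
  replace (w - v + - (v' - v))%C with (w - v')%C in T by ring.
  rewrite Cmod_opp in T; unfold k2, k3.
  replace (_ - (v' - v) * _)%C with
    (/ (w - v') * / (w - v') - / (w - v) * / (w - v) -
     - (v' - v) * (- (2) * (/ (w - v) * / (w - v) * / (w - v))))%C by ring.
  apply T; auto. }
(* With this function in place of [f], the denominator W is also of the form [J], and [J1] and [J2]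
   apply to it. *)
set (one := fun _ : C => RtoC 1).
pose (J g (k : C -> C -> C) v := rect_int (fun w => g w * k v w)%C a b c d).
assert (Hone : forall w, in_rect a b c d w -> cdiffable one w).
{ intros; apply cdiffable_const. }
assert (HMone : forall w, in_rect a b c d w -> Cmod (one w) <= 1).
{ intros; unfold one; rewrite Cmod_1; lra. }
assert (HW0 : forall v, Cmod (v - (x0, y0)) < r -> J one k1 v <> 0).
{ intros v Hv; apply Hball in Hv; destruct Hv as [Hv1 Hv2].
  apply Rabs_def2 in Hv1; apply Rabs_def2 in Hv2; unfold J.
  rewrite (rect_int_ext _ (fun w => / (w - v))%C).
  - apply winding_neq_0; unfold a, b, c, d; lra.
  - intros w; unfold one, k1; ring. }
assert (Hcauchy : forall v, Cmod (v - (x0, y0)) < r -> f v = (J f k1 v * / J one k1 v)%C).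
{ intros v Hv; assert (H0 := HW0 v Hv); apply Hball in Hv; destruct Hv as [Hv1 Hv2].
  apply Rabs_def2 in Hv1; apply Rabs_def2 in Hv2.
  replace (J f k1 v) with (f v * J one k1 v)%C; [field; auto|].
  unfold J, k1; rewrite (cauchy_formula f); auto; try (unfold a, b, c, d; lra).
  apply (f_equal (Cmult (f v))); apply rect_int_ext; intros w; unfold one; ring. }
pose (df v := (J f k2 v * / J one k1 v +
  J f k1 v * (J one k2 v * - / (J one k1 v * J one k1 v)))%C).
assert (Hdf : forall v, Cmod (v - (x0, y0)) < r -> C_derive f v = df v).
{ intros v Hv; apply cdiff_C_derive; destruct (Hsub v Hv) as [r' [Hr' Hs]].
  apply cdiff_ext_ball with (fun v => J f k1 v * / J one k1 v)%C r'; auto.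
  - intros w Hw; symmetry; auto.
  - apply (cdiff_mult (J f k1) (fun v => / J one k1 v)%C); [apply (J1 f M); auto|].
    apply (cdiff_comp_inv (J one k1)); auto; apply (J1 one 1); auto. }
assert (Hc : Cmod ((x0, y0) - (x0, y0)) < r).
{ replace ((x0, y0) - (x0, y0))%C with (RtoC 0) by ring; now rewrite Cmod_0. }
assert (Ddf : cdiffable df (x0, y0)).
{ assert (A1 : cdiffable (J f k1) (x0, y0)) by (eexists; apply (J1 f M); auto).
  assert (A2 : cdiffable (J f k2) (x0, y0)) by (eexists; apply (J2 f M); auto).
  assert (A3 : cdiffable (J one k1) (x0, y0)) by (eexists; apply (J1 one 1); auto).
  assert (A4 : cdiffable (J one k2) (x0, y0)) by (eexists; apply (J2 one 1); auto).
  assert (HW := HW0 _ Hc).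
  apply (cdiffable_plus (fun v => J f k2 v * / J one k1 v)%C).
  { apply (cdiffable_mult (J f k2)); auto; apply (cdiffable_inv (J one k1)); auto. }
  apply (cdiffable_mult (J f k1)); auto; apply (cdiffable_mult (J one k2)); auto.
  (* The remaining factor is a negated inverse, treated as 0 minus the inverse. *)
  destruct (cdiffable_inv (fun v => J one k1 v * J one k1 v)%C (x0, y0)) as [l Hl].
  - apply cdiffable_mult; auto.
  - now apply Cmult_neq_0.
  - exists (0 - l)%C.
    apply cdiff_ext_ball with (fun v => 0 - / (J one k1 v * J one k1 v))%C 1; [lra| |].
    + intros; ring.
    + apply cdiff_minus; auto; apply cdiff_const. }
destruct Ddf as [l Hl]; exists l.
apply cdiff_ext_ball with df r; auto.
intros w Hw; symmetry; auto.
Qed.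

(** * Derivatives along half-lines *)

Lemma open_cdiffable_C_derive (Omega : C -> Prop) (f : C -> C) :
  open Omega -> (forall z, Omega z -> cdiffable f z) ->
  forall z, Omega z -> cdiffable (C_derive f) z.
Proof.
intros HO Hf z Hz.
destruct (proj1 (locally_C z Omega) (HO z Hz)) as [r Hr].
apply cdiffable_C_derive with r; [apply cond_pos|].
intros w Hw; apply Hf, Hr, Hw.
Qed.

Lemma cdiff_C_derive_n (Omega : C -> Prop) (f : C -> C) (n : nat) :
  open Omega -> holomorphic_on Omega f ->
  forall z, Omega z -> cdiff (C_derive_n f n) z (C_derive_n f (S n) z).
Proof.
intros HO Hf z Hz.
assert (H : cdiffable (C_derive_n f n) z).
{ revert z Hz; induction n as [|n IH]; intros z Hz.
  - destruct (Hf z Hz) as [l Hl]; exists l; now apply cdiff_is_derive.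
  - now apply open_cdiffable_C_derive with Omega. }
destruct H as [l Hl]; simpl; now rewrite (cdiff_C_derive _ _ _ Hl).
Qed.

(** Stated for the real and imaginary parts, because the mean value theorem used below is one for
    real-valued functions. *)
Lemma is_derive_along_line (g : C -> C) (z h l : C) (t : R) :
  Cmod h = 1 -> cdiff g (z + RtoC t * h) l ->
  is_derive (fun s => fst (g (z + RtoC s * h)%C)) t (fst (l * h)%C) /\
  is_derive (fun s => snd (g (z + RtoC s * h)%C)) t (snd (l * h)%C).
Proof.
intros Hh Hg.
assert (D : forall s, ((z + RtoC s * h) - (z + RtoC t * h))%C = (RtoC (s - t) * h)%C).
{ intros s; rewrite RtoC_minus; ring. }
assert (N : forall s, Cmod ((z + RtoC s * h) - (z + RtoC t * h)) = Rabs (s - t)).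
{ intros s; rewrite D Cmod_mult Cmod_R Hh; ring. }
set (err := fun s => (g (z + RtoC s * h) - g (z + RtoC t * h) -
  RtoC (s - t) * (l * h))%C).
assert (Herr : forall eps, 0 < eps -> exists d, 0 < d /\ forall s, Rabs (s - t) < d ->
  Rmax (Rabs (fst (err s))) (Rabs (snd (err s))) <= eps * Rabs (s - t)).
{ intros eps Heps; destruct (Hg eps Heps) as [d [Hd H]].
  exists d; split; [exact Hd|]; intros s; rewrite -N; intros Hs.
  apply Rle_trans with (1 := Rmax_Cmod _); apply Rle_trans with (2 := H _ Hs).
  apply Req_le, f_equal; unfold err; rewrite D; ring. }
split; (split; [apply is_linear_scal_l|]); intros x Hx;
  rewrite <- (is_filter_lim_locally_unique _ _ Hx); intros eps;
  destruct (Herr eps (cond_pos eps)) as [d [Hd H]];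
  exists (mkposreal d Hd); intros s Hs; specialize (H s Hs).
- apply Rle_trans with (2 := H), Rle_trans with (2 := Rmax_l _ _), Req_le.
  apply (f_equal Rabs); unfold minus, plus, opp, scal; simpl; unfold mult; simpl; ring.
- apply Rle_trans with (2 := H), Rle_trans with (2 := Rmax_r _ _), Req_le.
  apply (f_equal Rabs); unfold minus, plus, opp, scal; simpl; unfold mult; simpl; ring.
Qed.

(* Mean value theorem between two points at distance at least 1 given by the
   induction hypothesis on consecutive intervals. *)
Lemma small_derivative_point (u : nat -> R -> R) (A : R) :
  (forall k t, 0 <= t -> is_derive (u k) t (u (S k) t)) ->
  (forall t, 0 <= t -> Rabs (u O t) <= A) ->
  forall n t, 0 <= t ->
  exists xi, t <= xi <= t + (2 ^ n - 1) /\ Rabs (u n xi) <= 2 ^ n * A.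
Proof.
intros Hu HA; induction n as [|n IH]; intros t Ht.
- exists t; simpl; split; [lra|]; rewrite Rmult_1_l; auto.
- assert (Hp : 1 <= 2 ^ n) by (apply pow_R1_Rle; lra).
  destruct (IH t Ht) as [x1 [Hx1 B1]].
  (* Starting at t + 2^n leaves a gap of length 1 after the first interval, and both together end at
     t + 2^(n+1) - 1. *)
  destruct (IH (t + 2 ^ n)) as [x2 [Hx2 B2]]; [lra|].
  destruct (MVT_gen (u n) x1 x2 (u (S n))) as [xi [Hxi E]].
  + rewrite Rmin_left; [|lra]; intros x Hx; apply Hu; lra.
  + rewrite Rmin_left; [|lra]; intros x Hx; apply continuity_pt_filterlim.
    apply: ex_derive_continuous; eexists; apply Hu; lra.
  + rewrite Rmin_left in Hxi; [|lra]; rewrite Rmax_right in Hxi; [|lra].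
    exists xi; split; [simpl; lra|].
    assert (T := Rabs_triang (u n x2) (- u n x1)); rewrite Rabs_Ropp in T.
    fold (u n x2 - u n x1) in T; rewrite E Rabs_mult (Rabs_pos_eq (x2 - x1)) in T; [|lra].
    assert (P := Rabs_pos (u (S n) xi)); simpl; nra.
Qed.

(** Descent on the top order [n]. [K] is chosen before [u], which later makes the bound uniform over
    all half-lines. *)
Lemma landau_half_line (n k : nat) (A B : R) :
  (k <= n)%nat -> exists K, forall u : nat -> R -> R,
  (forall k t, 0 <= t -> is_derive (u k) t (u (S k) t)) ->
  (forall t, 0 <= t -> Rabs (u O t) <= A) ->
  (forall t, 0 <= t -> Rabs (u n t) <= B) ->
  forall t, 0 <= t -> Rabs (u k t) <= K.
Proof.
revert B; induction n as [|n IH]; intros B Hk.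
{ exists B; intros u _ _ HB; replace k with O by lia; exact HB. }
destruct (Nat.eq_dec k (S n)) as [-> | Hne]; [now exists B|].
(* A bound for [u n]: its size at the point of [small_derivative_point], plus its variation from t
   to that point, at distance less than 2^n. *)
destruct (IH (2 ^ n * A + B * 2 ^ n)) as [K HK]; [lia|].
exists K; intros u Hu HA HB; apply HK; auto; intros t Ht.
assert (Hp : 1 <= 2 ^ n) by (apply pow_R1_Rle; lra).
destruct (small_derivative_point u A Hu HA n t Ht) as [x [Hx Hs]].
destruct (MVT_gen (u n) t x (u (S n))) as [xi [Hxi E]].
+ rewrite Rmin_left; [|lra]; intros y Hy; apply Hu; lra.
+ rewrite Rmin_left; [|lra]; intros y Hy; apply continuity_pt_filterlim.
  apply: ex_derive_continuous; eexists; apply Hu; lra.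
+ rewrite Rmin_left in Hxi; [|lra].
  replace (u n t) with (u n x + - (u (S n) xi * (x - t))) by lra.
  apply Rle_trans with (1 := Rabs_triang _ _); rewrite Rabs_Ropp Rabs_mult.
  rewrite (Rabs_pos_eq (x - t)); [|lra].
  assert (P := Rabs_pos (u (S n) xi)); assert (Q := HB xi ltac:(lra)); nra.
Qed.

(** The part of a half-line beyond one of its points is a half-line in the same direction. Including
    [s = 0] lets bounds along it be read off at [z] itself. *)
Lemma half_line_from (Omega : C -> Prop) (z : C) :
  union_of_open_half_lines Omega -> Omega z ->
  exists h : C, Cmod h = 1 /\ forall s, 0 <= s -> Omega (z + RtoC s * h)%C.
Proof.
intros [family [Hfam HO]] Hz.
destruct (proj1 (HO z) Hz) as [L [HL HLz]].
destruct (Hfam L HL) as [beta [h [Hh HLh]]]; exists h; split; [exact Hh|].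
intros s Hs; apply HO; exists L; split; [exact HL|].
apply HLh in HLz; destruct HLz as [t [Ht ->]].
apply HLh; exists (t + s); split; [lra|]; rewrite RtoC_plus; ring.
Qed.

Lemma intermediate_derivative_bounded (Omega : C -> Prop) (f : C -> C) (m l n : nat) :
  open Omega -> union_of_open_half_lines Omega -> holomorphic_on Omega f ->
  (m <= l <= n)%nat ->
  bounded_on Omega (C_derive_n f m) -> bounded_on Omega (C_derive_n f n) ->
  bounded_on Omega (C_derive_n f l).
Proof.
intros HO Hlines Hf Hmln [A HA] [B HB].
destruct (landau_half_line (n - m) (l - m) A B) as [K HK]; [lia|].
(* Real and imaginary parts are each bounded by [K], which was fixed before [z]. *)
exists (sqrt 2 * K); intros z Hz.
destruct (half_line_from Omega z Hlines Hz) as [h [Hh Hs]].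
(* This is h^k, the factor that k differentiations along the direction h produce; it has modulus
   1. *)
pose (hp := fun k => Nat.iter k (Cmult h) 1).
assert (Hhp : forall k, Cmod (hp k) = 1).
{ induction k as [|k IH]; simpl; [apply Cmod_1|].
  rewrite Cmod_mult Hh; fold (hp k); rewrite IH; ring. }
pose (G := fun k w => (hp k * C_derive_n f (k + m) w)%C).
assert (HG : forall k w, Cmod (G k w) = Cmod (C_derive_n f (k + m) w)).
{ intros k w; unfold G; rewrite Cmod_mult Hhp; ring. }
assert (D : forall k t, 0 <= t ->
  is_derive (fun s => fst (G k (z + RtoC s * h)%C)) t (fst (G (S k) (z + RtoC t * h)%C)) /\
  is_derive (fun s => snd (G k (z + RtoC s * h)%C)) t (snd (G (S k) (z + RtoC t * h)%C))).
{ intros k t Ht.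
  replace (G (S k) (z + RtoC t * h)%C) with
    (hp k * C_derive_n f (S (k + m)) (z + RtoC t * h) * h)%C
    by (unfold G, hp; simpl; ring).
  apply is_derive_along_line; auto.
  replace (hp k * _)%C with (0 * C_derive_n f (k + m) (z + RtoC t * h) +
    hp k * C_derive_n f (S (k + m)) (z + RtoC t * h))%C by ring.
  apply (cdiff_mult (fun _ => hp k)); [apply cdiff_const|].
  apply cdiff_C_derive_n with Omega; auto. }
assert (HA' : forall w, Omega w -> Cmod (G O w) <= A) by (intros; rewrite HG; auto).
assert (HB' : forall w, Omega w -> Cmod (G (n - m)%nat w) <= B).
{ intros w Hw; rewrite HG; replace (n - m + m)%nat with n by lia; auto. }
assert (E : (z + RtoC 0 * h)%C = z) by ring.
replace (Cmod (C_derive_n f l z)) with (Cmod (G (l - m)%nat (z + RtoC 0 * h)%C)).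
2:{ rewrite HG E; now replace (l - m + m)%nat with l by lia. }
apply Rle_trans with (1 := Cmod_2Rmax _).
apply Rmult_le_compat_l; [apply sqrt_pos|]; apply Rmax_lub.
- apply (HK (fun k s => fst (G k (z + RtoC s * h)%C))); try lra.
  + intros; now apply D.
  + intros t Ht; apply Rle_trans with (2 := HA' _ (Hs t Ht)),
      Rle_trans with (2 := Rmax_Cmod _), Rmax_l.
  + intros t Ht; apply Rle_trans with (2 := HB' _ (Hs t Ht)),
      Rle_trans with (2 := Rmax_Cmod _), Rmax_l.
- apply (HK (fun k s => snd (G k (z + RtoC s * h)%C))); try lra.
  + intros; now apply D.
  + intros t Ht; apply Rle_trans with (2 := HA' _ (Hs t Ht)),
      Rle_trans with (2 := Rmax_Cmod _), Rmax_r.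
  + intros t Ht; apply Rle_trans with (2 := HB' _ (Hs t Ht)),
      Rle_trans with (2 := Rmax_Cmod _), Rmax_r.
Qed.

(** * Filling the gaps of the index set, and the theorem *)

Lemma is_min_exists (F : nat -> Prop) : (exists n, F n) -> exists m, is_min F m.
Proof.
intros HF.
destruct (dec_inh_nat_subset_has_unique_least_element F) as [m [Hm _]]; auto.
- intros n; apply classic.
- now exists m.
Qed.

Lemma fill_of_mem (F : nat -> Prop) (l : nat) : F l -> fill F l.
Proof.
intros Hl; split.
- destruct (is_min_exists F) as [m Hm]; [now exists l|].
  exists m; split; [exact Hm | now apply Hm].
- apply (proj1 (Lub_Rbar_correct _)); now exists l.
Qed.

(** If no element of [F] were at least [l], then all would be at most l - 1, since they are
    integers, and so would their supremum. This treats finite and infinite suprema alike. *)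
Lemma fill_between (F : nat -> Prop) (l : nat) :
  fill F l -> exists m n, F m /\ F n /\ (m <= l <= n)%nat.
Proof.
intros [[m [[Hm _] Hml]] Hsup].
exists m; apply NNPP; intros Hno.
assert (Hub : Rbar_le (sup_nat F) (INR l - 1)).
{ apply (proj2 (Lub_Rbar_correct _)); intros x [n [Hn ->]]; simpl.
  assert (Hnl : (n + 1 <= l)%nat).
  { destruct (Nat.le_gt_cases l n); [exfalso; apply Hno; exists n; auto | lia]. }
  apply le_INR in Hnl; rewrite plus_INR in Hnl; simpl in Hnl; lra. }
assert (H := Rbar_le_trans _ _ _ Hsup Hub); simpl in H; lra.
Qed.

Theorem theorem4p2 (Omega : C -> Prop) (F : nat -> Prop)
  (Omega_open : open Omega)
  (Omega_half_lines : union_of_open_half_lines Omega)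
  (F_nonempty : exists n : nat, F n) :
  forall f : C -> C, H_inf F Omega f <-> H_inf (fill F) Omega f.
Proof.
intros f; split; intros [Hhol Hbd]; split; auto.
- intros l Hl; destruct (fill_between F l Hl) as [m [n [Hm [Hn Hmln]]]].
  apply intermediate_derivative_bounded with m n; auto.
- intros l Hl; apply Hbd, fill_of_mem, Hl.
Qed.
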